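(* Let $A\in\mathbb{R}^{n\times n}$ be an invertible matrix, $D\in\mathbb{R}^{n\times n}$, $c,d\in\mathbb{R}^n$, $q\in\mathbb{R}$, $\gamma\in\mathbb{R}_+$, $$Q=\{(x,t)\in\mathbb{R}^{n+1}:\|A(x-c)\|_2^2\le t\},\qquad F=\{(x,t)\in\mathbb{R}^{n+1}:\gamma t+q\le-\|D(x-d)\|_2^2\}.$$ Let $v_1,\dots,v_n\in\mathbb{R}^n$ and $\alpha_1,\dots,\alpha_n\in\mathbb{R}$ correspond to an eigenvalue decomposition of $A^{-T}D^TDA^{-1}$, so that $$A^{-T}D^TDA^{-1}=\sum_{i=1}^n\alpha_iv_iv_i^T,$$ with $\|v_i\|_2=1$ for all $i\in[n]$, $v_i^Tv_j=0$ for all $i\neq j$, and $\alpha_n\ge\alpha_i$ for all $i\in[n]$. Let $$R=\sum_{i=1}^{n-1}(\alpha_n-\alpha_i)v_iv_i^T,\quad e=\sum_{i=1}^n\alpha_i\bigl(v_i^TA(c-d)\bigr)v_i,\quad w=\sum_{i=1}^n\alpha_i\bigl(v_i^TA(c-d)\bigr)^2,$$ $$N=A^TRA,\quad a=-2A^Te-2A^TRAc,\quad f=c^TA^TRAc+2(A^Te)^Tc-w-q.$$ Then $$\mathrm{conv}\bigl(Q\setminus \mathrm{int}(F)\bigr)=\bigl\{(x,t)\in\mathbb{R}^{n+1}:\|A(x-c)\|_2^2\le t,\ \ x^TNx+a^Tx+f\le(\alpha_n+\gamma)t\bigr\}.$$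
   Context: $[n]=\{1,\dots,n\}$, $\mathbb{R}_+$ is the set of nonnegative reals, $A^{-T}=(A^{-1})^T$, and $\|\cdot\|_2$ is the Euclidean norm. $\mathrm{int}$ is the topological interior and $\mathrm{conv}$ the convex hull.
   Formalization: The case D = 0, γ = 0, q = 0 is excluded: there F and int(F) are all of R^{n+1}, so the left-hand side is empty, while the right-hand side equals the nonempty set Q and the identity fails. *)

(* Defs.v *)
From HB Require Import structures.
From mathcomp Require Export all_boot all_order all_algebra.
From mathcomp Require Export boolp classical_sets reals topology normedtype convex.

Set Implicit Arguments.
Unset Strict Implicit.
Unset Printing Implicit Defensive.

Import Order.TTheory GRing.Theory Num.Theory.
Import numFieldNormedType.Exports.

Local Open Scope classical_set_scope.
Local Open Scope ring_scope.

Definition dotv (R : realType) (n : nat) (u v : 'cV[R]_n) : R :=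
  (u^T *m v) 0 0.

(* The library norm on matrices is the sup norm, hence this definition. *)
Definition norm2 (R : realType) (n : nat) (u : 'cV[R]_n) : R :=
  Num.sqrt (\sum_(i < n) u i 0 ^+ 2).

Definition conv_hull (R : realType) (E : lmodType R) (X : set E) : set E :=
  smallest (@convex_set R E) X.

(* Main.v *)
(* With y = A (x - c), let P = t - |y|^2 and G = gamma t + q + |D (x - d)|^2.
   Outside the degenerate case, int F = {G < 0}, so Q \ int F = {P >= 0, G >= 0}.
   The right-hand side is {P >= 0, H >= 0} with H = G + alpha_n P, and H is
   concave because adding alpha_n P makes the quadratic part negative
   semidefinite with v_n in its kernel.
   If P >= 0, H >= 0 and G < 0, then alpha_n > 0 and P > 0; moving along
   (A^-1 v_n, tau), with tau chosen so that H stays constant, P is a concave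
   quadratic that vanishes on both sides, and at the two zeros G = H >= 0. *)
Require Import Defs.
From mathcomp Require Import ring lra interval_inference.

Set Implicit Arguments.
Unset Strict Implicit.
Unset Printing Implicit Defensive.

Import Order.TTheory GRing.Theory Num.Theory.
Import numFieldNormedType.Exports.

Local Open Scope classical_set_scope.
Local Open Scope ring_scope.

(** * Dot products and orthonormal expansions *)

Section Dot.
Variables (R : realType) (n : nat).
Implicit Types u w z : 'cV[R]_n.

Lemma dotvE u w : dotv u w = \sum_i u i 0 * w i 0.
Proof. by rewrite /dotv mxE; apply: eq_bigr => i _; rewrite mxE. Qed.

Lemma dotvC u w : dotv u w = dotv w u.
Proof. by rewrite !dotvE; apply: eq_bigr => i _; rewrite mulrC. Qed.

Lemma dotvDr u w z : dotv u (w + z) = dotv u w + dotv u z.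
Proof. by rewrite /dotv mulmxDr mxE. Qed.

Lemma dotvZr k u w : dotv u (k *: w) = k * dotv u w.
Proof. by rewrite /dotv -scalemxAr mxE. Qed.

Lemma dotvBr u w z : dotv u (w - z) = dotv u w - dotv u z.
Proof. by rewrite -scaleN1r dotvDr dotvZr mulN1r. Qed.

Lemma dotvDl u w z : dotv (w + z) u = dotv w u + dotv z u.
Proof. by rewrite dotvC dotvDr !(dotvC u). Qed.

Lemma dotvZl k u w : dotv (k *: w) u = k * dotv w u.
Proof. by rewrite dotvC dotvZr (dotvC u). Qed.

Lemma dotvBl u w z : dotv (w - z) u = dotv w u - dotv z u.
Proof. by rewrite dotvC dotvBr !(dotvC u). Qed.

Lemma dotv_suml (I : finType) (P : pred I) (x : I -> 'cV[R]_n) u :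
  dotv (\sum_(i | P i) x i) u = \sum_(i | P i) dotv (x i) u.
Proof. by rewrite /dotv raddf_sum mulmx_suml summxE. Qed.

Lemma norm2_sqr u : norm2 u ^+ 2 = dotv u u.
Proof.
by rewrite dotvE /norm2 sqr_sqrtr ?sumr_ge0// => i _; rewrite sqr_ge0.
Qed.

End Dot.

Lemma dotv_mulmxl (R : realType) (m n : nat) (M : 'M[R]_(m, n)) u w :
  dotv (M^T *m u) w = dotv u (M *m w).
Proof. by rewrite /dotv trmx_mul trmxK mulmxA. Qed.

Lemma dotv_spectral (R : realType) (m n : nat) (P : pred 'I_m) (beta : 'I_m -> R)
    (v : 'I_m -> 'cV[R]_n) (u z : 'cV[R]_n) :
  dotv u ((\sum_(i | P i) beta i *: (v i *m (v i)^T)) *m z) =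
  \sum_(i | P i) beta i * (dotv (v i) u * dotv (v i) z).
Proof.
rewrite mulmx_suml dotvC dotv_suml; apply: eq_bigr => i _.
rewrite -scalemxAl dotvZl; congr (_ * _).
by rewrite -mulmxA [(v i)^T *m z]mx11_scalar mul_mx_scalar dotvZl mulrC.
Qed.

(** The matrix [V] with rows [v i] is square, so [V *m V^T = 1] also gives [V^T *m V = 1]; hence [V]
    preserves the norm. *)
Lemma parseval (R : realType) (n : nat) (v : 'I_n -> 'cV[R]_n) :
    (forall i, norm2 (v i) = 1) ->
    (forall i j, i != j -> dotv (v i) (v j) = 0) ->
  forall u, dotv u u = \sum_i dotv (v i) u ^+ 2.
Proof.
move=> v1 v0 u.
pose V := \matrix_(i, j) v i j 0.
have Vv (z : 'cV[R]_n) i : (V *m z) i 0 = dotv (v i) z.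
  by rewrite mxE dotvE; apply: eq_bigr => j _; rewrite mxE.
have : V *m V^T = 1%:M.
  apply/matrixP => i j; rewrite [RHS]mxE.
  have -> : (V *m V^T) i j = dotv (v i) (v j).
    by rewrite mxE dotvE; apply: eq_bigr => k _; rewrite !mxE.
  have [<-|/v0//] := eqVneq i j.
  by rewrite -norm2_sqr v1 expr1n.
move=> /mulmx1C VV; rewrite -{2}[u]mul1mx -VV -mulmxA -dotv_mulmxl trmxK dotvE.
by apply: eq_bigr => i _; rewrite Vv.
Qed.

(** * Convex quadratics and segments *)

Lemma sum_quad_convex (R : realType) (I : finType) (b r s s' : I -> R) (k : R) :
    (forall i, 0 <= b i) -> 0 <= k <= 1 ->
  \sum_i (b i * (k * s i + (1 - k) * s' i) ^+ 2
          + r i * (k * s i + (1 - k) * s' i)) <=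
  k * \sum_i (b i * s i ^+ 2 + r i * s i) +
  (1 - k) * \sum_i (b i * s' i ^+ 2 + r i * s' i).
Proof.
move=> b0 /andP[k0 k1]; rewrite !mulr_sumr -big_split/=; apply: ler_sum => i _.
rewrite -subr_ge0.
have -> : k * (b i * s i ^+ 2 + r i * s i) +
    (1 - k) * (b i * s' i ^+ 2 + r i * s' i) -
    (b i * (k * s i + (1 - k) * s' i) ^+ 2
          + r i * (k * s i + (1 - k) * s' i)) =
    b i * (k * (1 - k) * (s i - s' i) ^+ 2) by ring.
by rewrite mulr_ge0// mulr_ge0 ?sqr_ge0// mulr_ge0// subr_ge0.
Qed.

(** The discriminant [k ^+ 2 + 4 * a] exceeds [k ^+ 2], so its square root dominates [|k|] and the
    roots lie on both sides of 0. *)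
Lemma quad_roots_opp_sign (R : realType) (a k : R) : 0 < a ->
  exists l1 l2, [/\ l1 < 0, 0 < l2, a + k * l1 - l1 ^+ 2 = 0
                  & a + k * l2 - l2 ^+ 2 = 0].
Proof.
move=> a0; have D0 : 0 <= k ^+ 2 + 4 * a by rewrite addr_ge0 ?sqr_ge0// mulr_ge0// ltW.
have [r r0 DE] : exists2 r, 0 <= r & r ^+ 2 = k ^+ 2 + 4 * a.
  by exists (Num.sqrt (k ^+ 2 + 4 * a)); rewrite ?sqrtr_ge0 ?sqr_sqrtr.
have : `|k| < r.
  by rewrite -(ltr_pXn2r (ltn0Sn 1)) ?nnegrE// real_normK ?num_real// DE; lra.
rewrite ltr_norml => /andP[k1 k2].
exists ((k - r) / 2), ((k + r) / 2); split; lra.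
Qed.

(** The weight [l2 / (l2 - l1)] on the first endpoint cancels the component along [u]; it lies in
    [0, 1] because [l1 < 0 < l2]. *)
Lemma convex_set_segment (R : realType) (E : lmodType R) (C : set E)
    (p u : E) (l1 l2 : R) :
    convex_set (C : set (convex_lmodType E)) -> l1 < 0 -> 0 < l2 ->
  C (p + l1 *: u) -> C (p + l2 *: u) -> C p.
Proof.
move=> cC l10 l20 C1 C2.
have d0 : 0 < l2 - l1 by lra.
have k0 : 0 <= l2 / (l2 - l1) by rewrite divr_ge0 ?ltW.
have k1 : l2 / (l2 - l1) <= 1 by rewrite ler_pdivrMr//; lra.
have := cC _ _ (Itv01 k0 k1) (mem_set C1) (mem_set C2); rewrite inE.
congr (C _); rewrite /conv/= /unstable.onem !scalerDr !scalerA addrACA -!scalerDl.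
have -> : l2 / (l2 - l1) + (1 - l2 / (l2 - l1)) = 1 by ring.
have -> : l2 / (l2 - l1) * l1 + (1 - l2 / (l2 - l1)) * l2 = 0.
  by field; rewrite gt_eqF.
by rewrite scale1r scale0r addr0.
Qed.

Lemma interior_segment (R : realType) (E : normedModType R) (C : set E) (p u : E) :
  interior C p -> exists2 l : R, 0 < l & C (p + l *: u) /\ C (p - l *: u).
Proof.
move=> Cp.
have : \forall l \near (0 : R^o), C (p + l *: u).
  have cont : {for (0 : R^o), continuous (fun l : R^o => p + l *: u)}.
    by apply: cvgD; [exact: cvg_cst|apply: cvgZr_tmp; exact: cvg_id].
  by apply: cont; rewrite scale0r addr0.
move=> /nbhs_normP[e /= e0 He]; have e2 : `|e / 2| < e by rewrite gtr0_norm; lra.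
exists (e / 2); first lra.
split; first by apply: He; rewrite /= sub0r normrN.
by rewrite -scaleNr; apply: He; rewrite /= sub0r opprK.
Qed.

(** * The interior of F *)

Section Paraboloid.
Variables (R : realType) (m n : nat) (D : 'M[R]_(m, n.+1)) (d : 'cV[R]_n.+1).
Variables (q gamma : R).

Lemma paraboloid_fun_continuous :
  continuous (fun p : 'cV[R]_n.+1 * R =>
    gamma * p.2 + q + norm2 (D *m (p.1 - d)) ^+ 2).
Proof.
have -> : (fun p : 'cV[R]_n.+1 * R => gamma * p.2 + q + norm2 (D *m (p.1 - d)) ^+ 2) =
    fun p => gamma * p.2 + q +
      \sum_(i < m) (\sum_j D i j * (p.1 j 0 - d j 0)) * (\sum_j D i j * (p.1 j 0 - d j 0)).
  apply/funext => p; rewrite norm2_sqr dotvE; congr (_ + _).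
  apply: eq_bigr => i _; rewrite mxE.
  by congr (_ * _); apply: eq_bigr => j _; rewrite !mxE.
have cts i : continuous (fun p : 'cV[R]_n.+1 * R => \sum_j D i j * (p.1 j 0 - d j 0)).
  apply: (@continuous_big _ _ +%R 0 xpredT (@add_continuous R)) => j _ p.
  apply: cvgMl_tmp; apply: cvgB; last exact: cvg_cst.
  by apply: (@cvg_comp _ _ _ fst (fun x : 'cV[R]_n.+1 => x j 0) _ (nbhs p.1));
    [exact: cvg_fst|exact: coord_continuous].
move=> p; apply: cvgD; first by apply: cvgD; [apply: cvgMl_tmp; exact: cvg_snd|exact: cvg_cst].
apply: (cvg_big (@add_continuous R)) => i _.
by apply: cvgM; exact: cts.
Qed.

(** Since G is continuous, {G < 0} is open. Conversely, an interior point with G >= 0 has G = 0, and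
    moving away from it without leaving F forces the degenerate case. *)
Lemma interior_paraboloid : ~ [/\ D = 0, gamma = 0 & q = 0] ->
  interior [set p : 'cV[R]_n.+1 * R | gamma * p.2 + q <= - norm2 (D *m (p.1 - d)) ^+ 2] =
  [set p | gamma * p.2 + q + norm2 (D *m (p.1 - d)) ^+ 2 < 0].
Proof.
move=> nd; apply/seteqP; split=> [p /= Fp|p Gp].
  rewrite ltNge; apply/negP => Gp; apply: nd.
  have FG := nbhs_singleton Fp; rewrite /= in FG.
  have g0 : gamma = 0.
    (* Moving by [l] along (0, gamma) adds [l * gamma ^+ 2] to G, which is already nonnegative at
       [p] and must stay nonpositive. *)
    have [l l0 [/=]] := interior_segment (0, gamma) Fp.
    rewrite scaler0 addr0 => F1 _.
    have : l * gamma ^+ 2 <= 0 by rewrite /GRing.scale/= in F1; lra.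
    by rewrite pmulr_rle0// => H; apply/eqP; rewrite -sqrf_eq0 eq_le H sqr_ge0.
  have DE k u : D *m (p.1 + k *: u - d) = D *m (p.1 - d) + k *: (D *m u).
    by rewrite addrAC mulmxDr -scalemxAr.
  have Du (u : 'cV[R]_n.+1) : D *m u = 0.
    (* Adding the inequalities at [p + l u] and [p - l u] cancels the cross terms and leaves only
       the square of [D *m u]. *)
    have [l l0 [F1 F2]] := interior_segment (u, 0) Fp.
    have {}F1 : gamma * (p.2 + l * 0) + q <= - norm2 (D *m (p.1 + l *: u - d)) ^+ 2 := F1.
    have {}F2 : gamma * (p.2 - l * 0) + q <= - norm2 (D *m (p.1 + - l *: u - d)) ^+ 2.
      by rewrite scaleNr; exact: F2.
    have : l ^+ 2 * norm2 (D *m u) ^+ 2 <= 0.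
      move: F1 F2 Gp FG; rewrite !DE g0 !norm2_sqr !(dotvDl, dotvDr, dotvZl, dotvZr).
      by lra.
    rewrite pmulr_rle0 ?exprn_gt0// => H.
    have /eqP : norm2 (D *m u) ^+ 2 = 0 by apply/eqP; rewrite eq_le H sqr_ge0.
    rewrite norm2_sqr dotvE psumr_eq0 => [/allP Du0|i _]; last by rewrite -expr2 sqr_ge0.
    apply/matrixP => i j; rewrite ord1 [RHS]mxE.
    by have /implyP/(_ isT) := Du0 i (mem_index_enum _); rewrite -expr2 sqrf_eq0 => /eqP.
  split=> //; last by move: Gp FG; rewrite g0 Du norm2_sqr dotvE big1 => [|i _]; [lra|rewrite mxE mul0r].
  apply/matrixP => i j; have := congr1 (fun z : 'cV_m => z i 0) (Du (delta_mx j 0)).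
  by rewrite -colE !mxE.
have : open [set p : 'cV[R]_n.+1 * R | gamma * p.2 + q + norm2 (D *m (p.1 - d)) ^+ 2 < 0].
  apply: (open_comp _ (@open_lt R 0)).
  by move=> x _; exact: paraboloid_fun_continuous.
rewrite openE => /(_ _ Gp); apply: filterS => x /=; lra.
Qed.
End Paraboloid.

(** The hull is the intersection of all convex supersets, and each of them contains the
    combination. *)
Lemma conv_hull_convex (R : realType) (E : lmodType R) (X : set E) :
  convex_set (conv_hull X : set (convex_lmodType E)).
Proof.
move=> x y k; rewrite !inE => Xx Xy C [cC XC].
have := cC x y k; rewrite !inE; apply; first exact: Xx.
exact: Xy.
Qed.

(* Points (x, t) of R^(m+1) are pairs in 'cV[R]_m * R, with m = n.+1 >= 1, and
   the indices 1, ..., m are 'I_n.+1, the last one being ord_max.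
   The case D = 0, gamma = 0, q = 0 is excluded because the identity fails
   there: F and int F are the whole space, so the left-hand side is empty,
   whereas the right-hand side is Q. *)
Theorem corollary5p1 (R : realType) (n : nat)
  (A D : 'M[R]_n.+1) (c d : 'cV[R]_n.+1) (q gamma : R)
  (v : 'I_n.+1 -> 'cV[R]_n.+1) (alpha : 'I_n.+1 -> R)
  (A_inv : A \in unitmx)
  (gamma_ge0 : 0 <= gamma)
  (nondegenerate : ~ [/\ D = 0, gamma = 0 & q = 0])
  (decomposition : (invmx A)^T *m D^T *m D *m invmx A =
                   \sum_(i < n.+1) alpha i *: (v i *m (v i)^T))
  (v_unit : forall i, norm2 (v i) = 1)
  (v_orth : forall i j, i != j -> dotv (v i) (v j) = 0)
  (alpha_max : forall i, alpha i <= alpha ord_max) :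
  let Q : set ('cV[R]_n.+1 * R) :=
    [set p | norm2 (A *m (p.1 - c)) ^+ 2 <= p.2] in
  let F : set ('cV[R]_n.+1 * R) :=
    [set p | gamma * p.2 + q <= - norm2 (D *m (p.1 - d)) ^+ 2] in
  let Rmx : 'M[R]_n.+1 :=
    \sum_(i < n.+1 | i != ord_max)
      (alpha ord_max - alpha i) *: (v i *m (v i)^T) in
  let e : 'cV[R]_n.+1 :=
    \sum_(i < n.+1) (alpha i * dotv (v i) (A *m (c - d))) *: v i in
  let w : R :=
    \sum_(i < n.+1) alpha i * dotv (v i) (A *m (c - d)) ^+ 2 in
  let N : 'M[R]_n.+1 := A^T *m Rmx *m A in
  let a : 'cV[R]_n.+1 :=
    - 2 *: (A^T *m e) - 2 *: (A^T *m Rmx *m A *m c) in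
  let f : R :=
    dotv c (A^T *m Rmx *m A *m c) + 2 * dotv (A^T *m e) c - w - q in
  conv_hull (Q `\` interior F) =
  [set p | norm2 (A *m (p.1 - c)) ^+ 2 <= p.2 /\
           dotv p.1 (N *m p.1) + dotv a p.1 + f
             <= (alpha ord_max + gamma) * p.2].
Proof.
move=> Q F Rmx e w N a f.
pose am := alpha ord_max.
(* In the basis [v], [s x] and [b] are the coordinates of A(x - c) and A(c - d). Below, P = t - S, G
   = gamma t + q + am S - T + w and H = (am + gamma) t + q + w - T. *)
pose s x i := dotv (v i) (A *m (x - c)).
pose b i := dotv (v i) (A *m (c - d)).
pose S x := \sum_i s x i ^+ 2.
pose T x := \sum_i ((am - alpha i) * s x i ^+ 2 + - 2 * alpha i * b i * s x i).
have SE x : norm2 (A *m (x - c)) ^+ 2 = S x.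
  by rewrite norm2_sqr (parseval v_unit v_orth).
have ME y : norm2 (D *m (invmx A *m y)) ^+ 2 = \sum_i alpha i * dotv (v i) y ^+ 2.
  rewrite norm2_sqr -dotv_mulmxl -dotv_mulmxl dotvC !mulmxA decomposition.
  by rewrite dotv_spectral; apply: eq_bigr => i _; rewrite expr2.
have am_ge0 : 0 <= am.
  (* The largest eigenvalue is the value of the form at its own unit eigenvector, hence a squared
     norm. *)
  rewrite (_ : am = norm2 (D *m (invmx A *m v ord_max)) ^+ 2) ?sqr_ge0// ME.
  rewrite (bigD1 ord_max)//= big1 => [|i /v_orth ->]; last by rewrite expr0n mulr0.
  by rewrite -norm2_sqr v_unit !expr1n mulr1 addr0.
have DE x : norm2 (D *m (x - d)) ^+ 2 = \sum_i alpha i * (s x i + b i) ^+ 2.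
  rewrite -[x - d](mulKmx A_inv) ME; apply: eq_bigr => i _.
  by rewrite /s /b -dotvDr -mulmxDr addrA subrK.
have TE x : \sum_i alpha i * (s x i + b i) ^+ 2 = am * S x - T x + w.
  rewrite /S /T /w mulr_sumr -sumrB -big_split/=; apply: eq_bigr => i _.
  by rewrite -/(b i); ring.
have NE x : dotv x (N *m x) + dotv a x + f = T x - w - q.
  have RE y z : dotv y (Rmx *m z) =
      \sum_i (am - alpha i) * (dotv (v i) y * dotv (v i) z).
    (* The omitted index [ord_max] can be restored, since its coefficient is zero. *)
    rewrite dotv_spectral big_mkcond; apply: eq_bigr => i _.
    by case: eqVneq => // ->; rewrite subrr mul0r.
  have eE y : dotv e y = \sum_i alpha i * b i * dotv (v i) y.
    by rewrite dotv_suml; apply: eq_bigr => i _; rewrite dotvZl.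
  rewrite /N /a /f -!mulmxA !(dotvBl, dotvZl) ![dotv _ (A^T *m _)]dotvC !dotv_mulmxl.
  rewrite !eE ![dotv (Rmx *m _) _]dotvC !RE.
  have -> : T x = \sum_i (am - alpha i) * (dotv (v i) (A *m x) * dotv (v i) (A *m x)) +
      (-2 * (\sum_i alpha i * b i * dotv (v i) (A *m x)) -
       2 * (\sum_i (am - alpha i) * (dotv (v i) (A *m x) * dotv (v i) (A *m c)))) +
      (\sum_i (am - alpha i) * (dotv (v i) (A *m c) * dotv (v i) (A *m c)) +
       2 * (\sum_i alpha i * b i * dotv (v i) (A *m c))).
    rewrite !mulr_sumr -sumrB -!big_split/=; apply: eq_bigr => i _.
    by rewrite /s mulmxBr dotvBr; ring.
  by ring.
have s_conv k x y i : s (k *: x + (1 - k) *: y) i = k * s x i + (1 - k) * s y i.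
  rewrite /s -!dotvZr -dotvDr !scalemxAr -mulmxDr; congr (dotv _ (_ *m _)).
  by rewrite !scalerBr addrACA -opprD -[k *: c + _]scalerDl [k + _]addrC subrK scale1r.
(* Moving along [u] changes only the last coordinate of [s]. Its square has coefficient zero in [T],
   so [T] is affine in this direction. *)
pose u := invmx A *m v ord_max.
have s_line l x i : s (x + l *: u) i = s x i + l * (i == ord_max)%:R.
  rewrite /s addrAC mulmxDr dotvDr -scalemxAr dotvZr /u mulKVmx//; congr (_ + _ * _).
  by case: eqVneq => [->|/v_orth//]; rewrite -norm2_sqr v_unit expr1n.
have S_line l x : S (x + l *: u) = S x + 2 * l * s x ord_max + l ^+ 2.
  rewrite /S (bigD1 ord_max)//= [in RHS](bigD1 ord_max)//= s_line eqxx mulr1.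
  rewrite (eq_bigr (fun i => s x i ^+ 2)) => [|i /negbTE ni].
    by ring.
  by rewrite s_line ni mulr0 addr0.
have T_line l x : T (x + l *: u) = T x - 2 * l * am * b ord_max.
  rewrite /T (bigD1 ord_max)//= [in RHS](bigD1 ord_max)//= s_line eqxx mulr1.
  rewrite (eq_bigr (fun i => (am - alpha i) * s x i ^+ 2 + - 2 * alpha i * b i * s x i)) => [|i /negbTE ni].
    by rewrite /am; ring.
  by rewrite s_line ni mulr0 addr0.
have QF p : (Q `\` interior F) p <->
    S p.1 <= p.2 /\ 0 <= gamma * p.2 + q + (am * S p.1 - T p.1 + w).
  rewrite /setD/= interior_paraboloid//= DE TE /Q/= SE.
  by split=> -[Sp Gp]; split=> //; [rewrite leNgt|]; apply/negP; rewrite -?leNgt.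
set C := [set p | _].
have CE p : C p <-> S p.1 <= p.2 /\ T p.1 - w - q <= (am + gamma) * p.2.
  by rewrite /C /= SE NE.
apply/seteqP; split.
  apply: smallest_sub => [x y k|p /QF[Sp Gp]]; last first.
    (* H = G + am P is a sum of nonnegative terms. *)
    by apply/CE; split=> //; have := ler_wpM2l am_ge0 Sp; lra.
  rewrite !inE => /CE[Sx Tx] /CE[Sy Ty].
  have k01 : 0 <= k%:num <= 1 by rewrite ge0 le1.
  have /andP[k0] := k01; rewrite -subr_ge0 => k1.
  apply/(CE (k%:num *: x.1 + (1 - k%:num) *: y.1, k%:num * x.2 + (1 - k%:num) * y.2)).
  have SC : S (k%:num *: x.1 + (1 - k%:num) *: y.1) <= k%:num * S x.1 + (1 - k%:num) * S y.1.
    (* [S] is the instance of [sum_quad_convex] with unit squares and no linear part. *)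
    have S1 x' : S x' = \sum_i (1 * s x' i ^+ 2 + 0 * s x' i).
      by apply: eq_bigr => i _; rewrite mul1r mul0r addr0.
    rewrite !S1; under eq_bigr do rewrite s_conv.
    exact: (sum_quad_convex (fun=> 0) _ _ (fun=> ler01)).
  have TC : T (k%:num *: x.1 + (1 - k%:num) *: y.1) <= k%:num * T x.1 + (1 - k%:num) * T y.1.
    rewrite /T; under eq_bigr do rewrite s_conv.
    by apply: sum_quad_convex => // i; rewrite subr_ge0.
  have := ler_wpM2l k0 Sx; have := ler_wpM2l k1 Sy.
  have := ler_wpM2l k0 Tx; have := ler_wpM2l k1 Ty.
  by split=> /=; lra.
move=> p /CE[Sp Tp].
have [Gp|Gp] := leP 0 (gamma * p.2 + q + (am * S p.1 - T p.1 + w)).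
  by apply: sub_gen_smallest; apply/QF.
(* This is H - G, with H >= 0 > G. *)
have amP : 0 < am * (p.2 - S p.1) by lra.
have P0 : 0 < p.2 - S p.1.
  by rewrite lt_neqAle subr_ge0 Sp andbT; apply: contraTneq amP => <-; rewrite mulr0 ltxx.
have am0 : 0 < am by move: amP; rewrite pmulr_lgt0.
(* The slope of [T] along [u], divided by [am + gamma]: this keeps H constant along [(u, tau)]. *)
pose tau := - 2 * am * b ord_max / (am + gamma).
have tauE : (am + gamma) * tau = - 2 * am * b ord_max.
  by rewrite /tau mulrC divfK// gt_eqF// ltr_wpDr.
(* The quadratic in [l] is P at [p + l *: (u, tau)]. *)
have [l1 [l2 [l10 l20 P1 P2]]] := quad_roots_opp_sign (tau - 2 * s p.1 ord_max) P0.
have endpoint l : p.2 - S p.1 + (tau - 2 * s p.1 ord_max) * l - l ^+ 2 = 0 ->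
    conv_hull (Q `\` interior F) (p + l *: (u, tau)).
  move=> Pl; apply: sub_gen_smallest; apply/QF.
  have -> : (p + l *: (u, tau)).1 = p.1 + l *: u by [].
  have -> : (p + l *: (u, tau)).2 = p.2 + l * tau by [].
  rewrite S_line T_line.
  (* At a root P vanishes, so G there equals H, which has kept its nonnegative value at [p]. *)
  have -> : S p.1 + 2 * l * s p.1 ord_max + l ^+ 2 = p.2 + l * tau by lra.
  split=> //; have : l * ((am + gamma) * tau) = l * (- 2 * am * b ord_max) by rewrite tauE.
  by lra.
exact: (convex_set_segment (@conv_hull_convex _ _ _) l10 l20 (endpoint _ P1) (endpoint _ P2)).
Qed.
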